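(* Let $A$ be a semisimple Banach algebra, let $a,b\in\mathrm{Soc}(A)$, and suppose that $a$ assumes its rank on $\mathrm{comm}(a)$ and $b$ assumes its rank on $\mathrm{comm}(b)$. Then $\rho(a,b)=0$ if and only if $a=b$.
   Context: Banach algebras are over $\mathbb{C}$ and have a unit $1$; $\sigma(x)$ is the spectrum of $x\in A$ and $\sigma'(x)=\sigma(x)\setminus\{0\}$. For $a,b\in A$ let $C_{a,b}:A\to A$ be the bounded operator $C_{a,b}x=ax-xb$, and put $\rho(a,b)=\limsup_{n\to\infty}\|C_{a,b}^n1\|^{1/n}$. $\mathrm{Soc}(A)$ (the socle) is the two-sided ideal of all finite sums of rank one elements, where $0\neq u\in A$ is rank one if $uAu\subseteq\mathbb{C}u$ (the zero element is included as the empty sum). $\mathrm{comm}(a)=\{y\in A: ya=ay\}$. For $a\in A$, $\mathrm{rank}(a)=\sup_{x\in A}\#\sigma'(xa)\le\infty$, where $\#K$ is the number of distinct elements of $K\subseteq\mathbb{C}$; $\mathrm{rank}(a)$ is finite for $a\in\mathrm{Soc}(A)$. One says $a$ assumes its rank on $\mathrm{comm}(a)$ if there is $y\in\mathrm{comm}(a)$ with $\#\sigma'(ya)=\mathrm{rank}(a)$. *)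

(* Defs.v *)
From HB Require Import structures.
From mathcomp Require Import all_boot all_order all_algebra.
From mathcomp Require Import all_classical all_reals all_analysis.
From mathcomp Require Import complex.

Set Implicit Arguments.
Unset Strict Implicit.
Unset Printing Implicit Defensive.

Import Order.TTheory GRing.Theory Num.Theory.
Import numFieldNormedType.Exports.

Local Open Scope classical_set_scope.
Local Open Scope ring_scope.

(* The norm is a separate R-valued operation: the norm of
   completeNormedModType R[i] is R[i]-valued, and the hierarchy admits no
   structure joining it with algType R[i] (missing join below numDomainType).
   No normalization bnorm 1 = 1 is imposed. *)
HB.mixin Record Algebra_isBanach (R : realType) A of GRing.Algebra R[i] A := {
  bnorm : A -> R;
  bnorm_eq0 : forall x, bnorm x = 0 -> x = 0;
  ler_bnormD : forall x y, bnorm (x + y) <= bnorm x + bnorm y;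
  bnormZ : forall (l : R[i]) x,
    bnorm (l *: x) = ComplexField.Normc.normc l * bnorm x;
  ler_bnormM : forall x y, bnorm (x * y) <= bnorm x * bnorm y;
  bnorm_complete : forall u : nat -> A,
    (forall e : R, 0 < e -> exists N : nat, forall m n : nat,
      (N <= m)%N -> (N <= n)%N -> bnorm (u m - u n) < e) ->
    exists l : A, bnorm (u n - l) @[n --> \oo] --> (0 : R)
}.

#[short(type="banachAlgType")]
HB.structure Definition BanachAlgebra (R : realType) :=
  {A of GRing.Algebra R[i] A & Algebra_isBanach R A}.

Section Radical.
Variable A : nzRingType.

Definition left_ideal (I : set A) : Prop :=
  [/\ I 0, forall x y, I x -> I y -> I (x + y)
    & forall r x, I x -> I (r * x)].

Definition maximal_left_ideal (M : set A) : Prop :=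
  [/\ left_ideal M, M <> setT
    & forall I, left_ideal I -> M `<=` I -> I = M \/ I = setT].

Definition jacobson_radical : set A :=
  \bigcap_(M in [set M : set A | maximal_left_ideal M]) M.

Definition semisimple : Prop := jacobson_radical = [set 0].

Definition invertible (x : A) : Prop := exists y, x * y = 1 /\ y * x = 1.

Definition comm (a : A) : set A := [set y | y * a = a * y].

End Radical.

Section SpectralNotions.
Variables (R : realType) (A : banachAlgType R).

Definition spectrum (x : A) : set R[i] :=
  [set l | ~ invertible (l%:A - x)].

Definition nonzero_spectrum (x : A) : set R[i] := spectrum x `\ 0.

Definition gen_comm (a b x : A) : A := a * x - x * b.

(* The term n = 0, where n%:R^-1 = 0, is irrelevant to the limit superior. *)
Definition rho (a b : A) : \bar R :=
  limn_esup (fun n : nat =>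
    (bnorm (iter n (gen_comm a b) 1) `^ (n%:R^-1))%:E).

Definition rank_one (u : A) : Prop :=
  u <> 0 /\ forall x : A, exists l : R[i], u * x * u = l *: u.

Definition Soc : set A :=
  [set a | exists (n : nat) (u : 'I_n -> A),
    (forall i, rank_one (u i)) /\ a = \sum_(i < n) u i].

Definition rank (a : A) : \bar R :=
  ereal_sup [set counting (nonzero_spectrum (x * a)) | x in [set: A]].

Definition assumes_rank_on_comm (a : A) : Prop :=
  exists2 y, comm a y & counting (nonzero_spectrum (y * a)) = rank a.

End SpectralNotions.

Arguments Soc {R} A _.
Arguments jacobson_radical A _ : clear implicits.

(* Main.v *)
Require Import Defs.
From HB Require Import structures.
From mathcomp Require Import all_boot all_order all_algebra.
From mathcomp Require Import all_classical all_reals all_analysis.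
From mathcomp Require Import complex.
From mathcomp Require Import ring.

Set Implicit Arguments.
Unset Strict Implicit.
Unset Printing Implicit Defensive.

Import Order.TTheory GRing.Theory Num.Theory.

Local Open Scope classical_set_scope.
Local Open Scope ring_scope.

(** An element of the socle that assumes its rank on its commutant is
    diagonalizable, and for diagonalizable elements the growth of C_{a,b}^n 1
    is explicit.

    Suppose 1 is a finite sum of elements e with a e = e a = mu e, and also a
    finite sum of elements f with b f = f b = nu f. Then
    e (C_{a,b}^n 1) f = (mu - nu)^n e f, so rho(a,b) = 0 forces e f = 0 as soon
    as mu <> nu ([rho_eq0_orthogonal]). Hence e (a - b) f = (mu - nu) e f
    vanishes for all e and f, and summing over both families gives a = b.

    Diagonalizability ([rank_maximal_diagonalizable]) comes from a perturbation
    argument. Let y commute with a and let c = y a have rank(a) distinct nonzero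
    spectral values. All elements of A a are algebraic, because the sum of an
    algebraic element and a rank one element is algebraic
    ([algebraic_rank_one_perturbation]); so the spectrum of such an element
    consists of eigenvalues of its left multiplication, and spectral idempotents
    are polynomials in it. Let e be the idempotent of c at lambda; it commutes
    with a. For lambda <> 0 let mu be an eigenvalue of a on e A, and put mu = 0
    when lambda = 0. If w = (a - mu) e were nonzero, semisimplicity would give
    an x for which e x w has the eigenvalue 1 on e A ([corner_eigenvector]).
    Multiples of e x w (and of e, if lambda <> 0) can then be added to
    (1 - e) c without leaving A a. This keeps the eigenvalues of c other than
    lambda and creates one new nonzero eigenvalue if lambda = 0, and two,
    against the one that is lost, if lambda <> 0. Either way some z a has more
    than rank(a) nonzero spectral values, a contradiction. So
    a e = mu e on each spectral idempotent of c, and these idempotents generate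
    the unit ideal of the polynomials in c ([ideal_without_zero]). *)

(** * Polynomials over an algebraically closed field *)

(** The weak Nullstellensatz in one variable. The ideal is given by a mere
    predicate, so that it can be a set of polynomials described through their
    values at an algebra element; the induction replaces [p] by its gcd with a
    member of [J] that does not vanish at a root of [p]. *)
Lemma ideal_without_zero (F : closedFieldType) (J : {poly F} -> Prop)
    (p : {poly F}) :
  (forall q r, J q -> J r -> J (q + r)) ->
  (forall q r, J r -> J (q * r)) ->
  p != 0 -> J p -> (forall l, exists2 q, J q & ~~ root q l) -> J 1.
Proof.
move=> JD JM + + Jl; have [n] := ubnP (size p).
elim: n p => // n IHn p /ltnSE lepn p0 Jp.
have [sp1|/closed_rootP[l pl]] := eqVneq (size p) 1.
  move: sp1 => /eqP/size_poly1P[c c0 pE].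
  by have := JM c^-1%:P _ Jp; rewrite pE -polyCM mulVf.
have [q Jq ql] := Jl l.
have [[u v] /= uvE] := Bezoutp p q.
have Jg : J (u * p + v * q) by apply: JD; exact: JM.
have gl : ~~ root (gcdp p q) l by rewrite root_gcd pl.
apply: (IHn (u * p + v * q)) => //; last first.
  by rewrite -size_poly_eq0 (eqp_size uvE) size_poly_eq0 gcdp_eq0 negb_and p0.
apply: leq_trans lepn; rewrite (eqp_size uvE) ltn_neqAle.
rewrite dvdp_leq ?dvdp_gcdl// andbT dvdp_size_eqp ?dvdp_gcdl//.
by apply: contra gl => /eqp_root ->.
Qed.

(** The product of X and all X - z, increased by 1, has a root, and this root is
    none of the z. *)
Lemma closed_field_avoid (F : closedFieldType) (s : seq F) :
  exists l, l \notin s.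
Proof.
have /closed_rootP[l /rootP] : size (\prod_(z <- 0 :: s) ('X - z%:P) + 1) != 1.
  by rewrite size_polyDl size_prod_XsubC // size_poly1.
rewrite hornerD hornerC => l0; exists l; apply/negP => ls.
have /rootP l1 : root (\prod_(z <- 0 :: s) ('X - z%:P)) l.
  by rewrite root_prod_XsubC inE ls orbT.
by move/eqP: l0; rewrite l1 add0r oner_eq0.
Qed.

(** * Algebraic elements of an algebra *)

Section AlgebraicElements.
Variables (F : closedFieldType) (A : algType F).
Implicit Types (z v x e : A) (l : F).

Definition algebraic z := exists2 p : {poly F}, p != 0 & horner_alg z p = 0.

(** Eigenvalues of left multiplication by [z]. For algebraic [z] they are the
    spectrum, and eigenvectors can be transported between [z] and elements that
    agree with it on part of the algebra. *)
Definition eigenval z l := exists2 v, v != 0 & z * v = l *: v.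

Lemma horner_alg_commute z x (p : {poly F}) :
  x * z = z * x -> x * horner_alg z p = horner_alg z p * x.
Proof.
move=> xz; elim/poly_ind: p => [|p c IHp]; first by rewrite !rmorph0 mulr0 mul0r.
rewrite rmorphD rmorphM /= horner_algX horner_algC mulrDr mulrDl mulrA IHp.
by rewrite -!mulrA xz mulr_algl mulr_algr.
Qed.

Lemma horner_alg_eigen z v l (p : {poly F}) :
  z * v = l *: v -> horner_alg z p * v = p.[l] *: v.
Proof.
move=> zv; elim/poly_ind: p => [|p c IHp].
  by rewrite rmorph0 mul0r horner0 scale0r.
rewrite rmorphD rmorphM /= horner_algX horner_algC mulrDl -mulrA zv mulr_algl.
by rewrite -scalerAr IHp scalerA hornerMXaddC scalerDl mulrC.
Qed.

(** Apply the linear factors of a polynomial that annihilates [z] to [x] one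
    after the other: the last nonzero value is an eigenvector. Being of the form
    q(z) x, it stays in e A when [x = e] commutes with [z]. *)
Lemma eigenvector_in_orbit z x : algebraic z -> x != 0 ->
  exists q l, horner_alg z q * x != 0 /\
    z * (horner_alg z q * x) = l *: (horner_alg z q * x).
Proof.
move=> [p p0 pz] x0.
have [r pE] := closed_field_poly_normal p.
have: horner_alg z (\prod_(t <- r) ('X - t%:P)) * x = 0.
  apply/eqP; move/eqP: pz; rewrite pE linearZ /= mulr_algl scaler_eq0.
  by rewrite lead_coef_eq0 (negbTE p0) /= => /eqP ->; rewrite mul0r.
elim: r x x0 {p p0 pz pE} => [|l r IHr] x x0.
  by rewrite big_nil rmorph1 mul1r => x00; rewrite x00 eqxx in x0.
rewrite big_cons mulrC rmorphM /= -mulrA.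
have [y0 _|y0] := eqVneq (horner_alg z ('X - l%:P) * x) 0.
  exists 1, l; rewrite rmorph1 mul1r; split => //.
  move/eqP: y0; rewrite rmorphB /= horner_algX horner_algC mulrBl mulr_algl.
  by rewrite subr_eq0 => /eqP.
move=> /(IHr _ y0)[q [k [qy0 qyE]]].
by exists (q * ('X - l%:P)), k; rewrite rmorphM /= -mulrA.
Qed.

(** The Riesz idempotent of [z] at [l], produced as a polynomial in [z] by a
    Bezout relation V q + U (X - l)^(N+1) = 1, where q is the part of an
    annihilating polynomial that does not vanish at [l]. The exponent is N+1
    rather than the multiplicity N, so that the last clause also covers points
    [l] outside the spectrum. *)
Lemma spectral_idempotent z l : algebraic z ->
  exists E : {poly F}, let e := horner_alg z E in
  [/\ ~~ root E l, e * e = e,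
      forall k v, k != l -> z * v = k *: v -> e * v = 0,
      l != 0 -> exists t : {poly F}, e = horner_alg z t * z
    & e = 0 -> exists u, u * (z - l%:A) = 1 /\ (z - l%:A) * u = 1].
Proof.
move=> [p p0 pz].
have [N [q qroot pE]] := multiplicity_XsubC p l.
move: qroot; rewrite p0 /= => ql.
set P := ('X - l%:P) ^+ N.+1.
have /Bezout_eq1_coprimepP[[V U] /= VU] : coprimep q P.
  by apply: coprimep_expr; rewrite coprimep_XsubC.
have Pz : horner_alg z (P * (V * q)) = 0.
  have -> : P * (V * q) = V * ('X - l%:P) * p.
    by rewrite pE /P exprSr; ring.
  by rewrite rmorphM /= pz mulr0.
have Pl : P.[l] = 0 by rewrite horner_exp !hornerE subrr expr0n.
exists (V * q); set e := horner_alg z (V * q).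
have VUl : (V * q).[l] = 1.
  by have /(congr1 (fun r => r.[l])) := VU; rewrite hornerD (hornerM U) Pl mulr0
    addr0 hornerC.
split.
- by rewrite rootE VUl oner_eq0.
- have eE : e = 1 - horner_alg z (U * P).
    by rewrite -(rmorph1 (horner_alg z)) -VU rmorphD /= addrK.
  rewrite {1}eE mulrBl mul1r -rmorphM -mulrA rmorphM /= Pz mulr0.
  by rewrite subr0.
- move=> k v kl zv; rewrite /e (horner_alg_eigen _ zv).
  have [->|v0] := eqVneq v 0; first by rewrite scaler0.
  have : horner_alg z (P * (V * q)) * v = 0 by rewrite Pz mul0r.
  rewrite (horner_alg_eigen _ zv) => /eqP.
  rewrite scaler_eq0 (negbTE v0) orbF hornerM mulf_eq0 horner_exp !hornerE.
  by rewrite expf_eq0 subr_eq0 (negbTE kl) /= => /eqP ->; rewrite scale0r.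
- move=> l0.
  (* P - P(0) is divisible by X, and P(z) e = 0: so e is a multiple of z e. *)
  have P0 : P.[0] != 0.
    by rewrite horner_exp !hornerE expf_neq0 // oppr_eq0.
  have /factor_theorem[t tE] : root (P - P.[0]%:P) 0.
    by rewrite rootE hornerD hornerN hornerC subrr.
  exists (- P.[0]^-1 *: (t * (V * q))).
  rewrite linearZ /= mulr_algl -scalerAl.
  have : horner_alg z ((P - P.[0]%:P) * (V * q)) = - P.[0] *: e.
    rewrite mulrBl rmorphB /= Pz sub0r rmorphM /= horner_algC mulr_algl.
    by rewrite scaleNr.
  rewrite tE subr0 mulrAC rmorphM /= horner_algX => ->.
  by rewrite scalerA mulrNN mulVf // scale1r.
- move=> e0.
  have UP1 : horner_alg z (U * P) = 1.
    by rewrite -(rmorph1 (horner_alg z)) -VU rmorphD /= -/e e0 add0r.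
  exists (horner_alg z (U * ('X - l%:P) ^+ N)).
  have zE : z - l%:A = horner_alg z ('X - l%:P).
    by rewrite rmorphB /= horner_algX horner_algC.
  have h : U * ('X - l%:P) ^+ N * ('X - l%:P) = U * P by rewrite -mulrA -exprSr.
  by rewrite zE -!rmorphM [in X in _ /\ X]mulrC h.
Qed.

Lemma eigenval_or_invertible z l : algebraic z ->
  eigenval z l \/ invertible (l%:A - z).
Proof.
move=> zalg; have [E [_ ee ek _ einv]] := spectral_idempotent l zalg.
set e := horner_alg z E in ee ek einv.
have [/einv [u [uz zu]]|e0] := eqVneq e 0.
  by right; exists (- u); rewrite -opprB mulrNN mulrNN.
left; have [q [k [v0 zv]]] := eigenvector_in_orbit zalg e0.
set v := _ * e in v0 zv; exists v => //.
have ev : e * v = v.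
  have ez : e * z = z * e by rewrite -horner_alg_commute.
  by rewrite /v mulrA (horner_alg_commute q ez) -mulrA ee.
have [<-//|kl] := eqVneq k l.
by rewrite -ev (ek k) // eqxx in v0.
Qed.

Lemma eigenval_not_invertible z l : eigenval z l -> ~ invertible (l%:A - z).
Proof.
move=> [v v0 zv] [u [_ uz]]; move/eqP: v0; apply.
by rewrite -[v]mul1r -uz -mulrA mulrBl mulr_algl zv subrr mulr0.
Qed.

(** If u f(b) u = l u then (b + u) f(b) u = (b f(b) + l) u; hence a
    polynomial in [b] times [u] is a polynomial of the same degree in [b + u]
    times [u]. For p(b) = 0 this yields c with c(b + u) u = 0, so right
    multiplication by [b + u] and by [b] agree on c(b + u), and c p annihilates
    [b + u]. *)
Lemma algebraic_rank_one_perturbation b u : algebraic b ->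
  (forall x, exists l : F, u * x * u = l *: u) -> algebraic (b + u).
Proof.
move=> [p p0 pb] uAu.
have chi (r : {poly F}) : exists2 c : {poly F},
    size c = size r & horner_alg (b + u) c * u = horner_alg b r * u.
  elim/poly_ind: r => [|r k [c cr cE]].
    by exists 0; rewrite ?size_poly0 // !rmorph0 !mul0r.
  have [r0|r0] := eqVneq r 0.
    by exists k%:P; rewrite r0 mul0r add0r // !horner_algC.
  have c0 : c != 0 by rewrite -size_poly_eq0 cr size_poly_eq0.
  have [l lE] := uAu (horner_alg b r).
  exists (c * 'X + (k - l)%:P).
    by rewrite !size_MXaddC (negbTE r0) (negbTE c0) cr.
  rewrite ![_ * 'X]mulrC !rmorphD !rmorphM /= !horner_algX !horner_algC.
  rewrite -[k%:A + _]scalerDl [LHS]mulrDl -mulrA cE [(b + u) * _]mulrDl [RHS]mulrDl.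
  rewrite -!mulrA !mulr_algl [u * (_ * _)]mulrA lE scalerBl.
  by rewrite -addrA [_ + (k *: u - _)]addrC subrK.
have [c csize cE] := chi p.
have c0 : c != 0 by rewrite -size_poly_eq0 csize size_poly_eq0.
exists (c * p); first by rewrite mulf_neq0.
have cu : horner_alg (b + u) c * u = 0 by rewrite cE pb mul0r.
rewrite rmorphM /=.
suff -> : horner_alg (b + u) c * horner_alg (b + u) p
        = horner_alg (b + u) c * horner_alg b p by rewrite pb mulr0.
elim/poly_ind: (p) => [|r k IHr]; first by rewrite !rmorph0.
rewrite !rmorphD !rmorphM /=.
rewrite !horner_algX !horner_algC [LHS]mulrDr [RHS]mulrDr; congr (_ + _).
(* Multiply by the last factor b + u next to c(b + u), where u is killed. *)
have cr : horner_alg (b + u) c * horner_alg (b + u) r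
        = horner_alg (b + u) r * horner_alg (b + u) c by rewrite -!rmorphM mulrC.
rewrite [LHS]mulrA cr -mulrA [_ c * (b + u)]mulrDr cu addr0 [LHS]mulrA -cr IHr.
by rewrite -mulrA.
Qed.

Lemma algebraic_sum_rank_one n (u : 'I_n -> A) :
  (forall i x, exists l : F, u i * x * u i = l *: u i) ->
  algebraic (\sum_(i < n) u i).
Proof.
elim: n u => [|n IHn] u uAu.
  by rewrite big_ord0; exists 'X; rewrite ?polyX_eq0 ?horner_algX.
by rewrite big_ord_recr; apply: algebraic_rank_one_perturbation; first exact: IHn.
Qed.
End AlgebraicElements.

(** * Semisimplicity and elements of maximal rank *)

(** A nonzero [w] lies outside some maximal left ideal M, so 1 = m + x w with
    m in M, and m cannot be invertible. *)
Lemma semisimple_non_invertible (A : nzRingType) (w : A) :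
  semisimple A -> w != 0 -> exists x, ~ invertible (1 - x * w).
Proof.
move=> ssA w0.
have : ~ jacobson_radical A w by rewrite ssA /= => /eqP; rewrite (negbTE w0).
move=> /existsNP[M /not_implyP[[[M0 MD MM] MT Mmax]] /= wM].
pose I := [set m + x * w | m in M & x in [set: A]].
have IM : M `<=` I by move=> m Mm; exists m => //; exists 0; rewrite // mul0r addr0.
have Iw : I w by exists 0 => //; exists 1; rewrite // mul1r add0r.
have Iideal : left_ideal I.
  split; first exact: IM.
  - move=> _ _ [m Mm [x _ <-]] [m' Mm' [x' _ <-]].
    by exists (m + m'); [exact: MD|exists (x + x'); rewrite // mulrDl addrACA].
  - move=> r _ [m Mm [x _ <-]].
    by exists (r * m); [exact: MM|exists (r * x); rewrite // mulrDr mulrA].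
have [IE|IE] := Mmax I Iideal IM; first by rewrite -IE in wM.
have [m Mm [x _ mxE]] : I 1 by rewrite IE.
exists x => -[u [_ ux]]; apply: MT; apply/seteqP; split => // r _.
rewrite -[r]mulr1 -ux mulrA; apply: MM.
by rewrite -mxE addrK.
Qed.

Section RankMaximal.
Variables (F : closedFieldType) (A : algType F).
Hypothesis ssA : semisimple A.
Implicit Types (z v x e w : A) (l : F).

(** Semisimplicity passed to the corner e A: this is where the new spectral
    value comes from when an element is assumed to violate maximality. *)
Lemma corner_eigenvector e w :
  e * e = e -> w * e = w -> w != 0 -> (forall x, algebraic (x * w)) ->
  exists x v, [/\ v != 0, e * v = v & e * x * w * v = v].
Proof.
move=> ee we w0 walg; have [x xw] := semisimple_non_invertible ssA w0.
have [[v v0 vE]|] := eigenval_or_invertible 1 (walg x); last by rewrite scale1r.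
rewrite scale1r in vE.
have wev : w * (e * v) = w * v by rewrite mulrA we.
exists x, (e * v); split; last 2 first.
- by rewrite mulrA ee.
- by rewrite -!mulrA wev [x * _]mulrA vE.
by apply: contra_neq v0 => ev0; rewrite -vE -mulrA -wev ev0 !mulr0.
Qed.

(** A weak form of diagonalizability: the identity is a sum of two-sided
    eigenvectors, which need not be orthogonal idempotents. *)
Definition diagonalizable_elt (a : A) := exists s : seq (F * A),
  (forall t, t \in s -> a * t.2 = t.1 *: t.2 /\ t.2 * a = t.1 *: t.2) /\
  \sum_(t <- s) t.2 = 1.

(** The list [s] stands for the nonzero spectrum of y a, and [s_max] says that y
    realizes the rank of a, in terms of eigenvalues. *)
Variables (a y : A) (s : seq F).
Hypothesis aalg : forall x, algebraic (x * a).
Hypothesis ya : y * a = a * y.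
Hypothesis s_uniq : uniq s.
Hypothesis s_neq0 : 0 \notin s.
Hypothesis s_eigen : forall l, l \in s -> eigenval (y * a) l.
Hypothesis s_max : forall z (r : seq F), uniq r -> 0 \notin r ->
  (forall l, l \in r -> eigenval (z * a) l) -> (size r <= size s)%N.

Let ca : y * a * a = a * (y * a). Proof. by rewrite {1}ya -mulrA. Qed.

(** The perturbation argument. Elements of the form ((1 - e) y + g e) a act as
    y a on the eigenvectors of y a that [e] kills ([off_e]) and as g a on e A
    ([in_e]), so [g] can be chosen freely to prescribe eigenvalues there. *)
Lemma spectral_piece_scalar l : exists E : {poly F}, ~~ root E l /\
  exists mu, a * horner_alg (y * a) E = mu *: horner_alg (y * a) E.
Proof.
have [E [El ee ek eT _]] := spectral_idempotent l (aalg y).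
exists E; split => //.
set e := horner_alg (y * a) E in ee ek eT *.
have ae : a * e = e * a by rewrite horner_alg_commute.
have ce : (y * a) * e = e * (y * a) by rewrite horner_alg_commute.
have in_e g v : e * v = v -> ((1 - e) * y + g * e) * a * v = g * (a * v).
  move=> ev; rewrite -mulrA mulrDl -{1}ev.
  have -> : (1 - e) * y * (a * (e * v)) = 0.
    rewrite -!mulrA [a * _]mulrA [y * _]mulrA [y * _]mulrA ce mulrA.
    by rewrite [(1 - e) * _]mulrA mulrBl mul1r ee subrr !mul0r.
  by rewrite add0r -mulrA [e * _]mulrA -ae -mulrA ev.
have off_e g k : k \in s -> k != l -> eigenval (((1 - e) * y + g * e) * a) k.
  move=> ks kl; have [v v0 vE] := s_eigen ks; exists v => //.
  have ev : e * v = 0 by apply: ek vE.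
  rewrite -mulrA mulrDl -mulrA [y * _]mulrA vE -scalerAr mulrBl mul1r ev subr0.
  by rewrite -mulrA [e * _]mulrA -ae -mulrA ev !mulr0 addr0.
have [l0|l0] := eqVneq l 0.
  (* At 0 any nonzero eigenvalue on e A is additional, so a e must vanish. *)
  exists 0; rewrite scale0r; apply/eqP/negPn/negP => w0.
  have [|x|x [v [v0 ev xv]]] := corner_eigenvector ee _ w0.
  - by rewrite -mulrA ee.
  - by rewrite ae mulrA.
  have [t] := closed_field_avoid (0 :: s).
  rewrite inE negb_or => /andP[t0 ts].
  suff : (size (t :: s) <= size s)%N by rewrite /= ltnn.
  apply: (@s_max ((1 - e) * y + t *: (e * x) * e)).
  - by rewrite /= ts.
  - by rewrite inE negb_or eq_sym t0.
  - move=> k; rewrite inE => /predU1P[->|ks]; last first.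
      by apply: off_e => //; rewrite l0; apply: contraNneq s_neq0 => <-.
    exists v => //; rewrite in_e // -scalerAl -{1}ev [a * _]mulrA mulrA.
    by rewrite xv.
have [e0|e0] := eqVneq e 0; first by exists 0; rewrite e0 mulr0 scaler0.
(* Away from 0 the idempotent is T(c) y a, hence lies in A a. *)
have [T TE] := eT l0; set Tc := horner_alg _ T in TE.
have aalg1 : algebraic a by rewrite -[a]mul1r.
have [q [mu [v0 v0E]]] := eigenvector_in_orbit aalg1 e0.
set v1 := _ * e in v0 v0E.
have ev1 : e * v1 = v1.
  by rewrite /v1 mulrA (horner_alg_commute q (esym ae)) -mulrA ee.
exists mu; apply/eqP; rewrite -subr_eq0; apply/negPn/negP => w0.
set w := a * e - _ in w0.
have we : w * e = w by rewrite /w mulrBl -scalerAl -mulrA ee.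
have wa : w = (a - mu%:A) * Tc * y * a.
  by rewrite -!mulrA -TE /w mulrBl mulr_algl.
have [|x [v [v0' ev xv]]] := corner_eigenvector ee we w0.
  by move=> x; rewrite wa mulrA.
have [al] := closed_field_avoid (0 :: s).
have [be] := closed_field_avoid (0 :: al :: s).
rewrite !inE !negb_or => /and3P[be0 beal bes] /andP[al0 als].
(* On e A the product g a acts as al e + (be - al) e x w; its value is al on v1,
   which w kills, and be on v, which e x w fixes. *)
pose g := (al *: e + (be - al) *: (e * x * w)) * Tc * y.
have gE u : e * u = u -> g * (a * u) = al *: u + (be - al) *: (e * x * w * u).
  move=> eu; rewrite /g -!mulrA [y * _]mulrA [Tc * _]mulrA -TE eu.
  by rewrite mulrDl -!scalerAl eu !mulrA.
suff : (size (be :: al :: rem l s) <= size s)%N.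
  have : (size s <= (size (rem l s)).+1)%N.
    have [ls|ls] := boolP (l \in s); last by rewrite rem_id.
    by rewrite size_rem // prednK // lt0n size_eq0; apply: contraTneq ls => ->.
  by move=> /leq_ltn_trans h /h; rewrite ltnn.
apply: (@s_max ((1 - e) * y + g * e)).
- rewrite /= inE negb_or beal rem_uniq // andbT.
  by rewrite !(contra (fun h => mem_rem h)).
- rewrite !inE !negb_or ![0 == _]eq_sym be0 al0.
  by rewrite (contra (fun h => mem_rem h)).
- move=> k; rewrite !inE => /or3P[/eqP->|/eqP->|].
  + exists v => //; rewrite in_e // gE // xv -scalerDl.
    by rewrite addrC subrK.
  + exists v1 => //; rewrite in_e // gE // -mulrA.
    have -> : w * v1 = 0.
      by rewrite /w mulrBl -scalerAl -mulrA ev1 v0E subrr.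
    by rewrite mulr0 scaler0 addr0.
  + by rewrite mem_rem_uniq // => /andP[kl ks]; apply: off_e.
Qed.

(** The polynomials P for which P(y a) is a sum of two-sided eigenvectors of [a]
    form an ideal, and by [spectral_piece_scalar] they have no common zero. *)
Lemma rank_maximal_diagonalizable : diagonalizable_elt a.
Proof.
pose eigs (r : seq (F * A)) := forall t, t \in r ->
  a * t.2 = t.1 *: t.2 /\ t.2 * a = t.1 *: t.2.
pose J P := exists2 r, eigs r & \sum_(t <- r) t.2 = horner_alg (y * a) P.
have [p p0 pc] := aalg y.
have [] : J 1; last by move=> r reig; rewrite rmorph1; exists r.
apply: (@ideal_without_zero _ J p) => //.
- move=> P Q [r rE rP] [r' rE' rQ]; exists (r ++ r').
    by move=> t; rewrite mem_cat => /orP[]; [exact: rE|exact: rE'].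
  by rewrite big_cat /= rP rQ rmorphD.
- move=> Q P [r rE rP].
  exists [seq (t.1, horner_alg (y * a) Q * t.2) | t <- r].
    move=> _ /mapP[t tr ->] /=; have [at1 at2] := rE t tr.
    rewrite mulrA horner_alg_commute ?ca // -!mulrA at1 at2.
    by rewrite -scalerAr.
  by rewrite big_map /= -mulr_sumr rP rmorphM.
- by exists [::] => //; rewrite big_nil pc.
- move=> l; have [E [El [mu muE]]] := spectral_piece_scalar l.
  exists E => //; exists [:: (mu, horner_alg (y * a) E)].
    move=> t; rewrite inE => /eqP -> /=.
    by rewrite muE -horner_alg_commute ?muE // ca.
  by rewrite big_seq1.
Qed.
End RankMaximal.

(** * The socle of a Banach algebra *)

Section SocleElements.
Variables (R : realType) (A : banachAlgType R).
Implicit Types (a b x y z e f : A) (l mu nu : R[i]).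

Lemma Soc_algebraic a x : Soc A a -> algebraic (x * a).
Proof.
move=> [n [u [u1 ->]]]; rewrite mulr_sumr; apply: algebraic_sum_rank_one => i y.
have [_ /(_ (y * x))[l lE]] := u1 i; exists l.
by rewrite scalerAr -lE !mulrA.
Qed.

Lemma nonzero_spectrum_algebraic z : algebraic z -> exists s : seq R[i],
  [/\ uniq s, forall l, l \in s <-> l != 0 /\ eigenval z l
    & counting (nonzero_spectrum z) = (size s)%:R%:E :> \bar R].
Proof.
move=> zalg.
have spE l : nonzero_spectrum z l <-> l != 0 /\ eigenval z l.
  split=> [[lsp /eqP l0]|[l0 /eigenval_not_invertible lsp]]; split => //.
    by have [|/lsp] := eigenval_or_invertible l zalg.
  exact/eqP.
have fin : finite_set (nonzero_spectrum z).
  have [p p0 pz] := zalg; have [r pE] := closed_field_poly_normal p.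
  apply: (@sub_finite_set _ _ [set` r]); last exact: finite_seq.
  move=> l /spE[_ [v v0 zv]] /=; rewrite -root_prod_XsubC rootE.
  have := horner_alg_eigen p zv; rewrite pz mul0r => /esym/eqP.
  rewrite scaler_eq0 (negbTE v0) orbF {1}pE hornerZ mulf_eq0 lead_coef_eq0.
  by rewrite (negbTE p0).
exists (finmap.enum_fset (fset_set (nonzero_spectrum z))).
split; first exact: finmap.fset_uniq.
- move=> l; rewrite -spE.
  have -> : (l \in finmap.enum_fset (fset_set (nonzero_spectrum z))) =
      (l \in nonzero_spectrum z) by exact: in_fset_set.
  by split => [/set_mem|/mem_set].
- by rewrite /counting asboolT.
Qed.

Lemma rank_on_comm_diagonalizable a :
  semisimple A -> Soc A a -> assumes_rank_on_comm a -> diagonalizable_elt a.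
Proof.
move=> ssA aS [y ya rky].
have aalg x : algebraic (x * a) by exact: Soc_algebraic.
have [s [s_uniq sE sc]] := nonzero_spectrum_algebraic (aalg y).
apply: (@rank_maximal_diagonalizable _ _ ssA a y s) => //.
- by apply/negP => /sE[]; rewrite eqxx.
- by move=> l /sE[].
move=> z r r_uniq r0 rE.
have [t [t_uniq tE tc]] := nonzero_spectrum_algebraic (aalg z).
apply: (@leq_trans (size t)).
  apply: uniq_leq_size => // l lr; apply/tE; split; last exact: rE.
  by apply: contraNneq r0 => <-.
have : (counting (nonzero_spectrum (z * a)%R) <= rank a)%E.
  by rewrite /rank; apply: ereal_sup_ubound; exists z.
by rewrite -rky sc tc lee_fin ler_nat.
Qed.

(** * Growth of the iterated commutator *)

Lemma bnorm0 : bnorm (0 : A) = 0.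
Proof.
by rewrite -(scale0r (0 : A)) bnormZ ComplexField.Normc.normc0 mul0r.
Qed.

Lemma bnorm_ge0 x : 0 <= bnorm x.
Proof.
have nN : bnorm (- x) = bnorm x.
  by rewrite -scaleN1r bnormZ normcN ComplexField.Normc.normc1 mul1r.
have := ler_bnormD x (- x); rewrite subrr bnorm0 nN -mulr2n.
by rewrite pmulrn_lge0.
Qed.

Lemma iter_gen_comm_eigen a b e f mu nu n :
  e * a = mu *: e -> b * f = nu *: f ->
  e * iter n (gen_comm a b) 1 * f = (mu - nu) ^+ n *: (e * f).
Proof.
move=> ea bf; elim: n => [|n IHn]; first by rewrite expr0 scale1r mulr1.
rewrite iterS /gen_comm mulrBr mulrBl !mulrA ea -!scalerAl.
rewrite -[X in _ - X]mulrA bf -scalerAr IHn -scalerBl scalerA.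
by rewrite exprS.
Qed.

Lemma rho_eq0_small a b (d : R) : rho a b = 0%E -> 0 < d ->
  exists N, forall n, (N <= n)%N -> bnorm (iter n (gen_comm a b) 1) <= d ^+ n.
Proof.
move=> rho0 d0.
set u := fun n => bnorm (iter n (gen_comm a b) 1).
have : ((u n `^ n%:R^-1)%:E @[n --> \oo] --> 0%:E)%E.
  apply: limn_esup_le_cvg.
    by have : (rho a b <= 0)%E by rewrite rho0.
  by move=> n; rewrite lee_fin powR_ge0.
move=> /fine_cvgP[_ /cvgr_lt/(_ d d0)] [N _ HN].
exists N.+1 => n Nn.
have := HN n (ltnW Nn); rewrite /= => und.
have n0 : n%:R != 0 :> R by rewrite pnatr_eq0 -lt0n (leq_trans _ Nn).
rewrite -[leLHS]powRr1 ?bnorm_ge0 // -(mulVf n0) powRrM powR_mulrn ?powR_ge0 //.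
by rewrite lerXn2r ?nnegrE ?powR_ge0 // ltW.
Qed.

(** With d = |mu - nu| > 0, the n-th iterate is eventually at most (d/2)^n in
    norm but dominates d^n |e f| up to a constant, so 2^n |e f| stays bounded. *)
Lemma rho_eq0_orthogonal a b e f mu nu : rho a b = 0%E ->
  e * a = mu *: e -> b * f = nu *: f -> (mu - nu) *: (e * f) = 0.
Proof.
move=> rho0 ea bf; have [->|munu] := eqVneq mu nu; first by rewrite subrr scale0r.
have [->|ef0] := eqVneq (e * f) 0; first by rewrite scaler0.
have normc_pos l : l != 0 -> 0 < ComplexField.Normc.normc l.
  move=> l0; rewrite lt_neqAle eq_sym; apply/andP; split.
    by apply: contra_neq l0; exact: ComplexField.Normc.eq0_normc.
  by case: (l) => ? ?; exact: sqrtr_ge0.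
set d := ComplexField.Normc.normc (mu - nu).
have d0 : 0 < d by apply: normc_pos; rewrite subr_eq0.
have ef_pos : 0 < bnorm (e * f).
  rewrite lt_neqAle bnorm_ge0 andbT eq_sym.
  by apply: contra_neq ef0; exact: bnorm_eq0.
have [N small] := rho_eq0_small rho0 (divr_gt0 d0 (ltr0n _ 2)).
set K := bnorm e * bnorm f.
have bound n : (N <= n)%N -> 2 ^+ n * bnorm (e * f) <= K.
  move=> Nn.
  have normcX k : ComplexField.Normc.normc ((mu - nu) ^+ k) = d ^+ k.
    elim: k => [|k IHk]; first exact: ComplexField.Normc.normc1.
    by rewrite !exprS ComplexField.Normc.normcM IHk.
  have : d ^+ n * bnorm (e * f) <= K * (d / 2) ^+ n.
    rewrite -normcX -bnormZ -(iter_gen_comm_eigen n ea bf).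
    apply: le_trans (ler_bnormM _ _) _; rewrite /K mulrAC.
    apply: ler_wpM2r; first exact: bnorm_ge0.
    apply: le_trans (ler_bnormM _ _) _.
    by apply: ler_wpM2l; [exact: bnorm_ge0|exact: small].
  rewrite expr_div_n [K * _]mulrCA ler_pM2l ?exprn_gt0 //.
  by rewrite ler_pdivlMr ?exprn_gt0 // mulrC.
pose n := maxn N (Num.bound (K / bnorm (e * f))).
have K0 : 0 <= K / bnorm (e * f) by rewrite divr_ge0 ?mulr_ge0 ?bnorm_ge0.
have := archi_boundP K0; rewrite ltr_pdivrMr // => Kn.
have := bound n (leq_maxl _ _); rewrite leNgt => /negP; case.
apply: lt_le_trans Kn _.
rewrite ler_pM2r // -natrX ler_nat; apply: (@leq_trans n); first exact: leq_maxr.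
by rewrite ltnW // ltn_expl.
Qed.

End SocleElements.

Theorem theorem4p6 (R : realType) (A : banachAlgType R) (a b : A)
  (hA : semisimple A) (ha : Soc A a) (hb : Soc A b)
  (hra : assumes_rank_on_comm a) (hrb : assumes_rank_on_comm b) :
  rho a b = 0%E <-> a = b.
Proof.
split=> [rho0|<-].
  have [s [sE s1]] := rank_on_comm_diagonalizable hA ha hra.
  have [t [tE t1]] := rank_on_comm_diagonalizable hA hb hrb.
  apply/eqP; rewrite -subr_eq0 -[a - b]mul1r -[_ * _]mulr1 -{1}s1 -t1.
  rewrite !mulr_suml big_seq big1 // => p ps.
  rewrite mulr_sumr big_seq big1 // => q qt.
  have [_ ea] := sE p ps; have [bf _] := tE q qt.
  have <- := rho_eq0_orthogonal rho0 ea bf.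
  by rewrite mulrBr mulrBl ea -mulrA bf -scalerAl -scalerAr scalerBl.
have C0 n : iter n.+1 (gen_comm a a) 1 = 0.
  elim: n => [|n IHn]; first by rewrite /= /gen_comm mulr1 mul1r subrr.
  by rewrite iterS IHn /gen_comm mulr0 mul0r subrr.
have u0 : (bnorm (iter n (gen_comm a a) 1) `^ n%:R^-1)%:E @[n --> \oo] --> 0%E.
  apply: cvg_near_cst; exists 1%N => // n /= n1.
  by rewrite -(prednK n1) C0 bnorm0 powR0 // invr_neq0 // pnatr_eq0.
by rewrite /rho is_cvg_limn_esupE; [exact/cvg_lim|apply/cvg_ex; exists 0%E].
Qed.
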